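(* Let $d=3$, $\ell=0$, $p=1$, $0<R_1<R_2$ and $\delta=R_2-R_1$. The mixed second-order coefficient at the Dirichlet–Dirichlet corner, $$g_{0,1}=-\frac1{\mathrm A_0'}\left[\mathrm D_0-\frac{\mathrm B_0\mathrm C_0'+\mathrm C_0\mathrm B_0'}{\mathrm A_0'}+\frac{\mathrm A_0''\,\mathrm B_0\,\mathrm C_0}{(\mathrm A_0')^2}\right]_{k=k_{0,1}^{DD}}$$ (primes denoting $\partial_k$), is $$g_{0,1}=\frac{2\pi}{\delta^3}.$$
   Context: With spherical Bessel functions $j_0(z)=\frac{\sin z}{z}$, $y_0(z)=-\frac{\cos z}{z}$, $j_1(z)=\frac{\sin z}{z^2}-\frac{\cos z}{z}$, $y_1(z)=-\frac{\cos z}{z^2}-\frac{\sin z}{z}$, the functions of $k>0$ are $$\mathrm A_0=j_0(kR_1)y_0(kR_2)-j_0(kR_2)y_0(kR_1),\qquad \mathrm B_0=k\bigl(j_1(kR_2)y_0(kR_1)-j_0(kR_1)y_1(kR_2)\bigr),$$ $$\mathrm C_0=k\bigl(j_1(kR_1)y_0(kR_2)-j_0(kR_2)y_1(kR_1)\bigr),\qquad \mathrm D_0=-k^2j_1(kR_1)y_1(kR_2)+k^2j_1(kR_2)y_1(kR_1).$$ The equation $\mathrm A_0\alpha_1\alpha_2+\mathrm B_0\alpha_1+\mathrm C_0\alpha_2+\mathrm D_0=0$ is the resonance condition for radial ($\ell=0$) solutions of the Helmholtz equation in the shell $R_1<|x|<R_2$ in $\mathbb R^3$ with Robin conditions $-u'+\alpha_1u=0$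 at $R_1$ and $u'+\alpha_2u=0$ at $R_2$. $k_{0,1}^{DD}$ is the first positive root of $\mathrm A_0(k)=0$ (the Dirichlet–Dirichlet limit $\alpha_1,\alpha_2\to\infty$). The number $g_{0,1}$ is the coefficient of $\mu_1\mu_2$, $\mu_i=1/\alpha_i$, in the expansion of the first resonance $k_{0,1}(\alpha_1,\alpha_2)$ at $\mu_1=\mu_2=0$. *)

(* Defs.v *)
(* Vanilla Stdlib reals with Coquelicot. *)
From Stdlib Require Import Reals.
From Coquelicot Require Import Coquelicot.
Open Scope R_scope.

(* The values at z = 0 are irrelevant: arguments are k * R with k, R > 0. *)
Definition j0 (z : R) : R := sin z / z.
Definition y0 (z : R) : R := - (cos z / z).
Definition j1 (z : R) : R := sin z / z ^ 2 - cos z / z.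
Definition y1 (z : R) : R := - (cos z / z ^ 2) - sin z / z.

Definition A0 (R1 R2 k : R) : R :=
  j0 (k * R1) * y0 (k * R2) - j0 (k * R2) * y0 (k * R1).
Definition B0 (R1 R2 k : R) : R :=
  k * (j1 (k * R2) * y0 (k * R1) - j0 (k * R1) * y1 (k * R2)).
Definition C0 (R1 R2 k : R) : R :=
  k * (j1 (k * R1) * y0 (k * R2) - j0 (k * R2) * y1 (k * R1)).
Definition D0 (R1 R2 k : R) : R :=
  - k ^ 2 * j1 (k * R1) * y1 (k * R2) + k ^ 2 * j1 (k * R2) * y1 (k * R1).

Definition resonance (R1 R2 alpha1 alpha2 k : R) : R :=
  A0 R1 R2 k * alpha1 * alpha2 + B0 R1 R2 k * alpha1 + C0 R1 R2 k * alpha2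
  + D0 R1 R2 k.

Definition is_first_positive_root (f : R -> R) (k : R) : Prop :=
  0 < k /\ f k = 0 /\ forall x : R, 0 < x < k -> f x <> 0.

(* K alpha1 alpha2 is only constrained near the Dirichlet-Dirichlet corner
   (both |alpha_i| large), which is all that matters for the expansion there. *)
Definition is_first_resonance (R1 R2 : R) (K : R -> R -> R) : Prop :=
  exists M : R, forall alpha1 alpha2 : R,
    M < Rabs alpha1 -> M < Rabs alpha2 ->
    is_first_positive_root (resonance R1 R2 alpha1 alpha2) (K alpha1 alpha2).

(* Second-order expansion of K in mu_i = 1 / alpha_i at mu = 0, with constant
   term k0, coefficient g of mu1 mu2, and remainder o(mu1^2 + mu2^2). The axes
   mu_i = 0 correspond to no finite alpha_i and are left out. *)
Definition is_mixed_coefficient (K : R -> R -> R) (k0 g : R) : Prop :=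
  exists c10 c01 c20 c02 : R,
    forall eps : R, 0 < eps ->
    exists eta : R, 0 < eta /\
    forall mu1 mu2 : R, 0 < Rabs mu1 < eta -> 0 < Rabs mu2 < eta ->
      Rabs (K (/ mu1) (/ mu2)
            - (k0 + c10 * mu1 + c01 * mu2
               + c20 * mu1 ^ 2 + g * (mu1 * mu2) + c02 * mu2 ^ 2))
      <= eps * (mu1 ^ 2 + mu2 ^ 2).

Definition g01 (R1 R2 k : R) : R :=
  let A' := Derive (A0 R1 R2) k in
  let A'' := Derive_n (A0 R1 R2) 2 k in
  let B := B0 R1 R2 k in
  let B' := Derive (B0 R1 R2) k in
  let C := C0 R1 R2 k in
  let C' := Derive (C0 R1 R2) k in
  let D := D0 R1 R2 k in
  - (1 / A') * (D - (B * C' + C * B') / A' + A'' * B * C / A' ^ 2).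

(* Main.v *)
(* In terms of the lengths [P = 1 / (alpha1 + 1 / R1)], [Q = 1 / (alpha2 - 1 / R2)]
   and of [d = R2 - R1], the resonance function is a nonvanishing multiple of
   [Im ((1 + i k P) (1 + i k Q) exp (i k d))]; hence the resonances are the
   [k > 0] with [k d + atan (k P) + atan (k Q)] in [PI Z]. For small [P], [Q]
   this phase is increasing in [k], so the first one is where it equals [PI].
   As [atan x = x + O(x^3)], the first resonance is [PI / (d + P + Q)] up to
   third order, which gives the coefficient [2 PI / d^3] of [mu1 mu2]. *)
Require Import Defs.
From Stdlib Require Import Reals Lra ClassicalEpsilon.
From Coquelicot Require Import Coquelicot.
Open Scope R_scope.

(** * Arctangent estimates *)

Definition phase (d P Q k : R) : R := k * d + atan (k * P) + atan (k * Q).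

Lemma atan_lipschitz (x y : R) : Rabs (atan x - atan y) <= Rabs (x - y).
Proof.
  destruct (MVT_gen atan y x (fun c => / (1 + c ^ 2))) as [c [_ Hc]].
  - intros t _. auto_derive; [easy|]. unfold Rsqr. field. nra.
  - intros t _. apply continuity_pt_filterlim.
    apply (ex_derive_continuous atan t). auto_derive. easy.
  - rewrite Hc, Rabs_mult.
    assert (H : 0 < / (1 + c ^ 2) <= 1).
    { split; [apply Rinv_0_lt_compat; nra|].
      rewrite <- Rinv_1. apply Rinv_le_contravar; nra. }
    rewrite (Rabs_pos_eq (/ _)) by lra.
    assert (H' := Rabs_pos (x - y)). nra.
Qed.

Lemma Rabs_atan_le (x : R) : Rabs (atan x) <= Rabs x.
Proof.
  assert (H := atan_lipschitz x 0). rewrite atan_0 in H.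
  now rewrite !Rminus_0_r in H.
Qed.

(** By the mean value theorem: the derivative of [atan t - t] at [c] is [- c ^ 2 / (1 + c ^ 2)], of
    size at most [c ^ 2 <= x ^ 2]. *)
Lemma Rabs_atan_minus_id_le (x : R) : Rabs (atan x - x) <= Rabs x ^ 3.
Proof.
  destruct (MVT_gen (fun t => atan t - t) 0 x (fun c => / (1 + c ^ 2) - 1))
    as [c [Hc1 Hc2]].
  - intros t _. auto_derive; [easy|]. unfold Rsqr. field. nra.
  - intros t _. apply continuity_pt_filterlim.
    apply (ex_derive_continuous (fun t => atan t - t) t). auto_derive. easy.
  - rewrite atan_0 in Hc2.
    replace (atan x - x) with ((/ (1 + c ^ 2) - 1) * (x - 0)) by lra.
    rewrite Rabs_mult, Rminus_0_r.
    assert (Hsq : c ^ 2 <= Rabs x ^ 2).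
    { rewrite pow2_abs. revert Hc1. unfold Rmin, Rmax.
      destruct (Rle_dec 0 x); nra. }
    assert (Hc : Rabs (/ (1 + c ^ 2) - 1) <= c ^ 2).
    { replace (/ (1 + c ^ 2) - 1) with (- (c ^ 2 * / (1 + c ^ 2)))
        by (field; nra).
      assert (H : 0 < / (1 + c ^ 2) <= 1).
      { split; [apply Rinv_0_lt_compat; nra|].
        rewrite <- Rinv_1. apply Rinv_le_contravar; nra. }
      rewrite Rabs_Ropp, Rabs_pos_eq; nra. }
    assert (H' := Rabs_pos x).
    apply Rle_trans with (Rabs x ^ 2 * Rabs x); [|right; ring].
    apply Rmult_le_compat_r; lra.
Qed.

Lemma is_first_positive_root_iff (f g : R -> R) (k : R) :
  (forall x, 0 < x -> (f x = 0 <-> g x = 0)) ->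
  is_first_positive_root f k <-> is_first_positive_root g k.
Proof.
  intros H. unfold is_first_positive_root.
  split; intros (H1 & H2 & H3); (split; [|split]); auto;
    try (now apply H); intros x Hx Hx0; apply (H3 x Hx), H; tauto.
Qed.

(** * The equation phase = PI for small boundary lengths *)

Section Phase.

Variables d P Q : R.
Hypothesis d_gt0 : 0 < d.
Hypothesis PQ_small : Rabs P + Rabs Q <= d / 2.

Lemma phase_0 : phase d P Q 0 = 0.
Proof. unfold phase. rewrite !Rmult_0_l, atan_0. ring. Qed.

Lemma continuity_phase : continuity (phase d P Q).
Proof.
  intros t. apply continuity_pt_filterlim.
  apply (ex_derive_continuous (phase d P Q) t). unfold phase.
  auto_derive. easy.
Qed.

(** Between [x] and [y] the two arctangents move by at most [(y - x) * (Rabs P + Rabs Q)], which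
    takes away at most half of the slope [d] of the linear term. *)
Lemma phase_growth (x y : R) :
  x <= y -> (y - x) * (d / 2) <= phase d P Q y - phase d P Q x.
Proof.
  intros Hxy.
  assert (HP := atan_lipschitz (y * P) (x * P)).
  assert (HQ := atan_lipschitz (y * Q) (x * Q)).
  rewrite <- Rmult_minus_distr_r, Rabs_mult, (Rabs_pos_eq (y - x)) in HP by lra.
  rewrite <- Rmult_minus_distr_r, Rabs_mult, (Rabs_pos_eq (y - x)) in HQ by lra.
  apply Rabs_le_between in HP. apply Rabs_le_between in HQ.
  unfold phase. nra.
Qed.

(** The phase vanishes at 0 and increases strictly, so its sine stays positive until the phase
    reaches [PI]. If the phase at a first root were above [PI], the intermediate value theorem would
    yield an earlier root. *)
Lemma first_root_sin_phase_iff (k : R) :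
  is_first_positive_root (fun x => sin (phase d P Q x)) k <->
  phase d P Q k = PI.
Proof.
  assert (HPI := PI_RGT_0). assert (H0 := phase_0).
  split.
  - intros (Hk & Hroot & Hfirst).
    assert (Hpos : 0 < phase d P Q k).
    { assert (H := phase_growth 0 k (Rlt_le _ _ Hk)). nra. }
    destruct (Rtotal_order (phase d P Q k) PI) as [H | [H | H]]; trivial.
    + assert (H' := sin_gt_0 _ Hpos H). lra.
    + destruct (IVT_gen (phase d P Q) 0 k PI) as [x [Hx1 Hx2]].
      * apply continuity_phase.
      * rewrite H0. unfold Rmin, Rmax. destruct (Rle_dec _ _); lra.
      * unfold Rmin, Rmax in Hx1. destruct (Rle_dec 0 k); [|lra].
        exfalso. apply (Hfirst x); [|rewrite Hx2; apply sin_PI].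
        split; apply Rnot_le_lt; intros Hle.
        -- replace x with 0 in Hx2 by lra. lra.
        -- replace x with k in Hx2 by lra. lra.
  - intros Hk.
    assert (Hk0 : 0 < k).
    { apply Rnot_le_lt. intros Hle.
      assert (H := phase_growth k 0 Hle). nra. }
    split; [trivial | split].
    + rewrite Hk. apply sin_PI.
    + intros x [Hx1 Hx2]. apply Rgt_not_eq, sin_gt_0.
      * assert (H := phase_growth 0 x (Rlt_le _ _ Hx1)). nra.
      * assert (H := phase_growth x k (Rlt_le _ _ Hx2)). nra.
Qed.

Lemma phase_eq_PI_ex : exists k, phase d P Q k = PI.
Proof.
  assert (HPI := PI_RGT_0).
  (* With slope at least [d / 2], the phase has reached [PI] by [2 * PI / d]. *)
  assert (Hpos : 0 <= 2 * PI / d) by (apply Rlt_le, Rdiv_lt_0_compat; lra).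
  assert (H := phase_growth 0 (2 * PI / d) Hpos).
  rewrite phase_0 in H.
  replace ((2 * PI / d - 0) * (d / 2)) with PI in H by (field; lra).
  destruct (IVT_gen (phase d P Q) 0 (2 * PI / d) PI) as [x [_ Hx]].
  - apply continuity_phase.
  - rewrite phase_0. unfold Rmin, Rmax. destruct (Rle_dec _ _); lra.
  - now exists x.
Qed.

(** This bound does not depend on [P] and [Q], which makes the cubic error of the next lemma
    uniform. *)
Lemma phase_eq_PI_bounds (k : R) :
  phase d P Q k = PI -> 0 < k <= 2 * PI / d.
Proof.
  intros Hk. assert (HPI := PI_RGT_0). split.
  - apply Rnot_le_lt. intros Hle.
    assert (H := phase_growth k 0 Hle). rewrite phase_0 in H. nra.
  - apply Rnot_lt_le. intros Hlt.
    assert (Hpos : 0 < 2 * PI / d) by (apply Rdiv_lt_0_compat; lra).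
    assert (H := phase_growth 0 k ltac:(lra)). rewrite phase_0 in H.
    assert (H' : 2 * PI / d * d = 2 * PI) by (field; lra). nra.
Qed.

(** The left side is the sum of the two errors made by linearising [atan] at [k * P] and [k * Q],
    each cubic in its argument. *)
Lemma phase_eq_PI_expansion (k : R) :
  phase d P Q k = PI ->
  Rabs (k * (d + P + Q) - PI)
    <= (2 * PI / d) ^ 3 * (Rabs P + Rabs Q) ^ 3.
Proof.
  intros Hk. destruct (phase_eq_PI_bounds k Hk) as [Hk0 Hk1].
  replace (k * (d + P + Q) - PI)
    with (- ((atan (k * P) - k * P) + (atan (k * Q) - k * Q)))
    by (unfold phase in Hk; lra).
  rewrite Rabs_Ropp.
  assert (HP := Rabs_atan_minus_id_le (k * P)).
  assert (HQ := Rabs_atan_minus_id_le (k * Q)).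
  rewrite Rabs_mult, Rpow_mult_distr, (Rabs_pos_eq k) in HP by lra.
  rewrite Rabs_mult, Rpow_mult_distr, (Rabs_pos_eq k) in HQ by lra.
  eapply Rle_trans; [apply Rabs_triang|].
  apply Rle_trans with (k ^ 3 * (Rabs P ^ 3 + Rabs Q ^ 3)); [lra|].
  assert (H1 := Rabs_pos P). assert (H2 := Rabs_pos Q).
  apply Rmult_le_compat.
  - apply pow_le; lra.
  - assert (H3 := pow_le _ 3 H1). assert (H4 := pow_le _ 3 H2). lra.
  - apply pow_incr; lra.
  - assert (0 <= 3 * (Rabs P * Rabs Q) * (Rabs P + Rabs Q)).
    { apply Rmult_le_pos; [|lra]. apply Rmult_le_pos; [lra|].
      now apply Rmult_le_pos. }
    lra.
Qed.

End Phase.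

(** * Closed forms of the Bessel cross products and the resonance function *)

Section Shell.

Variables R1 R2 : R.
Hypothesis R1_gt0 : 0 < R1.
Hypothesis R2_gt0 : 0 < R2.

Lemma sin_shell (k : R) :
  sin (k * (R2 - R1)) = sin (k * R2) * cos (k * R1) - cos (k * R2) * sin (k * R1).
Proof. rewrite Rmult_minus_distr_l. apply sin_minus. Qed.

Lemma cos_shell (k : R) :
  cos (k * (R2 - R1)) = cos (k * R2) * cos (k * R1) + sin (k * R2) * sin (k * R1).
Proof. rewrite Rmult_minus_distr_l. apply cos_minus. Qed.

Lemma A0_eq (k : R) : 0 < k ->
  A0 R1 R2 k = sin (k * (R2 - R1)) / (k ^ 2 * R1 * R2).
Proof.
  intros Hk. rewrite sin_shell. unfold A0, j0, y0. field. lra.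
Qed.

Lemma B0_eq (k : R) : 0 < k ->
  B0 R1 R2 k = cos (k * (R2 - R1)) / (k * R1 * R2)
               - sin (k * (R2 - R1)) / (k ^ 2 * R1 * R2 ^ 2).
Proof.
  intros Hk. rewrite sin_shell, cos_shell. unfold B0, j0, y0, j1, y1.
  field. lra.
Qed.

Lemma C0_eq (k : R) : 0 < k ->
  C0 R1 R2 k = cos (k * (R2 - R1)) / (k * R1 * R2)
               + sin (k * (R2 - R1)) / (k ^ 2 * R1 ^ 2 * R2).
Proof.
  intros Hk. rewrite sin_shell, cos_shell. unfold C0, j0, y0, j1, y1.
  field. lra.
Qed.

Lemma D0_eq (k : R) : 0 < k ->
  D0 R1 R2 k = cos (k * (R2 - R1)) * (R2 - R1) / (k * R1 ^ 2 * R2 ^ 2)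
               - sin (k * (R2 - R1)) / (k ^ 2 * R1 ^ 2 * R2 ^ 2)
               - sin (k * (R2 - R1)) / (R1 * R2).
Proof.
  intros Hk. rewrite sin_shell, cos_shell. unfold D0, j1, y1.
  field. lra.
Qed.

(** The last factor is the imaginary part of [(1 + i k P) (1 + i k Q) exp (i k d)]. The arctangents
    are the arguments of the first two factors, and their cosines are the inverses of the moduli. *)
Lemma sin_phase (d P Q k : R) :
  sin (phase d P Q k) =
  cos (atan (k * P)) * cos (atan (k * Q)) *
  (sin (k * d) * (1 - k ^ 2 * P * Q) + k * cos (k * d) * (P + Q)).
Proof.
  assert (H : forall x, sin (atan x) = x * cos (atan x)).
  { intros x. rewrite sin_atan, cos_atan. unfold Rdiv. ring. }
  unfold phase. rewrite !sin_plus, !cos_plus, !H. ring.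
Qed.

Lemma cos_atan_neq0 (x : R) : cos (atan x) <> 0.
Proof.
  destruct (atan_bound x) as [H1 H2].
  apply Rgt_not_eq, cos_gt_0; lra.
Qed.

(** If [u] is a radial solution, then [v = r u] satisfies [v'' = - k ^ 2 v], and the Robin
    conditions become [- v' + (alpha1 + 1 / R1) v = 0] at [R1] and [v' + (alpha2 - 1 / R2) v = 0] at
    [R2]. This explains the shifted parameters. *)
Lemma resonance_eq0_iff (alpha1 alpha2 k : R) :
  0 < k -> alpha1 + / R1 <> 0 -> alpha2 - / R2 <> 0 ->
  resonance R1 R2 alpha1 alpha2 k = 0 <->
  sin (phase (R2 - R1) (/ (alpha1 + / R1)) (/ (alpha2 - / R2)) k) = 0.
Proof.
  intros Hk H1 H2.
  rewrite sin_phase.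
  set (P := / (alpha1 + / R1)). set (Q := / (alpha2 - / R2)).
  set (F := sin (k * (R2 - R1)) * _ + _).
  assert (HR : resonance R1 R2 alpha1 alpha2 k
               = (alpha1 + / R1) * (alpha2 - / R2) / (k ^ 2 * R1 * R2) * F).
  (* Multiplying by [/ P * / Q] makes [F] polynomial in the shifted parameters, ready for comparison
     with the closed forms of the four coefficients. *)
  { assert (HF : (alpha1 + / R1) * (alpha2 - / R2) * F
       = sin (k * (R2 - R1)) * ((alpha1 + / R1) * (alpha2 - / R2) - k ^ 2)
         + k * cos (k * (R2 - R1)) * (alpha2 - / R2 + (alpha1 + / R1))).
    { unfold F.
      replace ((alpha1 + / R1) * (alpha2 - / R2)) with (/ P * / Q)
        by (unfold P, Q; rewrite !Rinv_inv; ring).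
      replace (alpha2 - / R2) with (/ Q) by apply Rinv_inv.
      replace (alpha1 + / R1) with (/ P) by apply Rinv_inv.
      field. split; apply Rinv_neq_0_compat; trivial. }
    unfold Rdiv. rewrite (Rmult_assoc _ (/ _) F), (Rmult_comm (/ _) F),
      <- Rmult_assoc, HF.
    unfold resonance. rewrite A0_eq, B0_eq, C0_eq, D0_eq by trivial.
    field. lra. }
  rewrite HR.
  assert (HP := cos_atan_neq0 (k * P)). assert (HQ := cos_atan_neq0 (k * Q)).
  assert (Hc : (alpha1 + / R1) * (alpha2 - / R2) / (k ^ 2 * R1 * R2) <> 0).
  { unfold Rdiv. apply Rmult_integral_contrapositive_currified.
    - now apply Rmult_integral_contrapositive_currified.
    - apply Rinv_neq_0_compat, Rgt_not_eq.
      apply Rmult_gt_0_compat; [apply Rmult_gt_0_compat|]; nra. }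
  split; intros H.
  - apply Rmult_integral in H. destruct H as [H | H]; [easy|].
    rewrite H. ring.
  - apply Rmult_integral in H. destruct H as [H | H].
    + apply Rmult_integral in H. tauto.
    + rewrite H. ring.
Qed.

(** The Dirichlet-Dirichlet limit is the case of zero boundary lengths, so its first root falls
    under the same phase criterion. *)
Lemma A0_eq0_iff (k : R) : 0 < k ->
  A0 R1 R2 k = 0 <-> sin (phase (R2 - R1) 0 0 k) = 0.
Proof.
  intros Hk. rewrite A0_eq by trivial. unfold phase.
  rewrite Rmult_0_r, atan_0, !Rplus_0_r.
  assert (H : 0 < / (k ^ 2 * R1 * R2)).
  { apply Rinv_0_lt_compat, Rmult_lt_0_compat; [|trivial].
    apply Rmult_lt_0_compat; nra. }
  unfold Rdiv. split; intros H'; [|rewrite H'; ring].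
  apply Rmult_integral in H'. destruct H'; lra.
Qed.

Lemma Derive_A0_eq (k : R) : 0 < k ->
  Derive (A0 R1 R2) k =
  ((R2 - R1) * cos (k * (R2 - R1)) / k ^ 2 - 2 * sin (k * (R2 - R1)) / k ^ 3)
    / (R1 * R2).
Proof.
  intros Hk.
  (* The closed form is known for positive arguments only, so it replaces [A0] in a neighbourhood of
     [k]. The derivatives below are treated in the same way. *)
  rewrite (Derive_ext_loc _ (fun x => sin (x * (R2 - R1)) / (x ^ 2 * R1 * R2))).
  - apply is_derive_unique. auto_derive.
    + apply Rgt_not_eq, Rmult_gt_0_compat; [apply Rmult_gt_0_compat|]; nra.
    + field. lra.
  - apply (locally_interval _ k 0 p_infty); simpl; trivial.
    intros x Hx _. now apply A0_eq.
Qed.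

Lemma Derive_2_A0_eq (k : R) : 0 < k ->
  Derive_n (A0 R1 R2) 2 k =
  (- (R2 - R1) ^ 2 * sin (k * (R2 - R1)) / k ^ 2
   - 4 * (R2 - R1) * cos (k * (R2 - R1)) / k ^ 3
   + 6 * sin (k * (R2 - R1)) / k ^ 4) / (R1 * R2).
Proof.
  intros Hk. simpl Derive_n.
  rewrite (Derive_ext_loc _ (fun x =>
    ((R2 - R1) * cos (x * (R2 - R1)) / x ^ 2 - 2 * sin (x * (R2 - R1)) / x ^ 3)
    / (R1 * R2))).
  - apply is_derive_unique. auto_derive.
    + repeat split; apply Rgt_not_eq; try apply Rmult_gt_0_compat; nra.
    + field. lra.
  - apply (locally_interval _ k 0 p_infty); simpl; trivial.
    intros x Hx _. now apply Derive_A0_eq.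
Qed.

Lemma Derive_B0_eq (k : R) : 0 < k ->
  Derive (B0 R1 R2) k =
  (- (R2 - R1) * sin (k * (R2 - R1)) / k - cos (k * (R2 - R1)) / k ^ 2
   - (R2 - R1) * cos (k * (R2 - R1)) / (k ^ 2 * R2)
   + 2 * sin (k * (R2 - R1)) / (k ^ 3 * R2)) / (R1 * R2).
Proof.
  intros Hk.
  rewrite (Derive_ext_loc _ (fun x => cos (x * (R2 - R1)) / (x * R1 * R2)
               - sin (x * (R2 - R1)) / (x ^ 2 * R1 * R2 ^ 2))).
  - apply is_derive_unique. auto_derive.
    + repeat split; apply Rgt_not_eq; repeat apply Rmult_gt_0_compat; lra.
    + field. lra.
  - apply (locally_interval _ k 0 p_infty); simpl; trivial.
    intros x Hx _. now apply B0_eq.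
Qed.

Lemma Derive_C0_eq (k : R) : 0 < k ->
  Derive (C0 R1 R2) k =
  (- (R2 - R1) * sin (k * (R2 - R1)) / k - cos (k * (R2 - R1)) / k ^ 2
   + (R2 - R1) * cos (k * (R2 - R1)) / (k ^ 2 * R1)
   - 2 * sin (k * (R2 - R1)) / (k ^ 3 * R1)) / (R1 * R2).
Proof.
  intros Hk.
  rewrite (Derive_ext_loc _ (fun x => cos (x * (R2 - R1)) / (x * R1 * R2)
               + sin (x * (R2 - R1)) / (x ^ 2 * R1 ^ 2 * R2))).
  - apply is_derive_unique. auto_derive.
    + repeat split; apply Rgt_not_eq; repeat apply Rmult_gt_0_compat; lra.
    + field. lra.
  - apply (locally_interval _ k 0 p_infty); simpl; trivial.
    intros x Hx _. now apply C0_eq.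
Qed.

End Shell.

(** At this point the sine is 0 and the cosine is -1. Writing [d = R2 - R1], the term [D0] cancels
    the part of [(B C' + C B') / A'] that carries the factor [d ^ 2 / (R1 * R2)], and
    [2 * k / d ^ 2] remains. *)
Lemma g01_eq (R1 R2 : R) : 0 < R1 -> R1 < R2 ->
  g01 R1 R2 (PI / (R2 - R1)) = 2 * PI / (R2 - R1) ^ 3.
Proof.
  intros H1 H2. assert (HPI := PI_RGT_0).
  assert (Hk : 0 < PI / (R2 - R1)) by (apply Rdiv_lt_0_compat; lra).
  assert (H2' : 0 < R2) by lra.
  unfold g01.
  rewrite Derive_A0_eq, Derive_2_A0_eq, Derive_B0_eq, Derive_C0_eq,
    B0_eq, C0_eq, D0_eq by trivial.
  replace (PI / (R2 - R1) * (R2 - R1)) with PI by (field; lra).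
  rewrite sin_PI, cos_PI. field. repeat split; try lra.
Qed.

(** * Second-order expansion in the inverse Robin parameters *)

Lemma shifted_inv_bounds (s p : R) :
  p <> 0 -> Rabs s * Rabs p <= / 2 ->
  / p + s <> 0 /\
  Rabs (/ (/ p + s)) <= 2 * Rabs p /\
  Rabs (/ (/ p + s) - p) <= 2 * Rabs s * Rabs p ^ 2 /\
  Rabs (/ (/ p + s) - p + s * p ^ 2) <= 2 * Rabs s ^ 2 * Rabs p ^ 3.
Proof.
  intros Hp Hs.
  (* The inverse is [p / (1 + s * p)], and the three bounds are remainders of its geometric series
     [p - s * p ^ 2 + ...]; the denominator being at least 1/2 accounts for each factor 2. *)
  assert (Hu : / 2 <= 1 + s * p).
  { rewrite <- Rabs_mult in Hs. apply Rabs_le_between in Hs. lra. }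
  assert (Hu' : Rabs (/ (1 + s * p)) <= 2).
  { rewrite Rabs_pos_eq; [|apply Rlt_le, Rinv_0_lt_compat; lra].
    rewrite <- (Rinv_inv 2). apply Rinv_le_contravar; lra. }
  assert (Hn : / p + s <> 0).
  { replace (/ p + s) with ((1 + s * p) * / p) by (field; trivial).
    apply Rmult_integral_contrapositive_currified; [lra|].
    now apply Rinv_neq_0_compat. }
  assert (He : / (/ p + s) = / (1 + s * p) * p).
  { field. repeat split; lra. }
  split; [trivial|]. rewrite He.
  assert (HP := Rabs_pos p). assert (HS := Rabs_pos s).
  split; [|split].
  - rewrite Rabs_mult. now apply Rmult_le_compat_r.
  - replace (/ (1 + s * p) * p - p) with (- (/ (1 + s * p) * (s * p ^ 2)))
      by (field; lra).
    rewrite Rabs_Ropp, !Rabs_mult, <- RPow_abs, Rmult_assoc.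
    apply Rmult_le_compat_r; [|trivial].
    apply Rmult_le_pos; [trivial|now apply pow_le].
  - replace (/ (1 + s * p) * p - p + s * p ^ 2)
      with (/ (1 + s * p) * (s ^ 2 * p ^ 3)) by (field; lra).
    rewrite !Rabs_mult, <- !RPow_abs, Rmult_assoc.
    apply Rmult_le_compat_r; [|trivial].
    apply Rmult_le_pos; now apply pow_le.
Qed.

(** Up to second order [k] is [PI / (d + P + Q)], with [P = p - s1 * p ^ 2 + ...] and
    [Q = q - s2 * q ^ 2 + ...]. The shifts thus affect only the pure squares, and the mixed term is
    that of [PI / (d + p + q)]. *)
Lemma phase_eq_PI_boundary_expansion (d s1 s2 S p q k : R) :
  0 < d -> Rabs s1 <= S -> Rabs s2 <= S -> p <> 0 -> q <> 0 ->
  S * Rabs p <= / 2 -> S * Rabs q <= / 2 -> Rabs p + Rabs q <= d / 4 ->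
  phase d (/ (/ p + s1)) (/ (/ q + s2)) k = PI ->
  Rabs (k - (PI / d - PI / d ^ 2 * p - PI / d ^ 2 * q
             + (PI / d ^ 3 + PI / d ^ 2 * s1) * p ^ 2
             + 2 * PI / d ^ 3 * (p * q)
             + (PI / d ^ 3 + PI / d ^ 2 * s2) * q ^ 2))
  <= (16 / d * (2 * PI / d) ^ 3 + 16 / d * (PI / d ^ 3)
      + 2 * S ^ 2 * (PI / d ^ 2) + 6 * S * (PI / d ^ 3))
     * (Rabs p + Rabs q) ^ 3.
Proof.
  intros Hd Hs1 Hs2 Hp Hq Sp Sq Hpq Hk.
  assert (HPI := PI_RGT_0).
  assert (Ap := Rabs_pos p). assert (Aq := Rabs_pos q).
  assert (As1 := Rabs_pos s1). assert (As2 := Rabs_pos s2).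
  destruct (shifted_inv_bounds s1 p Hp) as (_ & P1 & P2 & P3); [nra|].
  destruct (shifted_inv_bounds s2 q Hq) as (_ & Q1 & Q2 & Q3); [nra|].
  set (P := / (/ p + s1)) in *. set (Q := / (/ q + s2)) in *.
  set (m := Rabs p + Rabs q) in *.
  assert (Hm : 0 <= m) by (unfold m; lra).
  assert (Hexp := phase_eq_PI_expansion d P Q Hd ltac:(unfold m in *; lra) k Hk).
  assert (Hsum : Rabs (P + Q) <= 2 * m).
  { eapply Rle_trans; [apply Rabs_triang|]. unfold m. lra. }
  assert (Hw : d / 2 <= d + (P + Q)).
  { apply Rabs_le_between in Hsum. lra. }
  assert (Hiw : 0 < / (d + (P + Q)) <= 2 / d).
  { split; [apply Rinv_0_lt_compat; lra|].
    replace (2 / d) with (/ (d / 2)) by (field; lra).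
    apply Rinv_le_contravar; lra. }
  assert (HS2 : S ^ 2 >= Rabs s1 ^ 2 /\ S ^ 2 >= Rabs s2 ^ 2)
    by (split; apply Rle_ge, pow_incr; lra).
  assert (Hm2 : Rabs p ^ 2 + Rabs q ^ 2 <= m ^ 2) by (unfold m; nra).
  assert (Hm3 : Rabs p ^ 3 + Rabs q ^ 3 <= m ^ 3).
  { assert (0 <= 3 * (Rabs p * Rabs q) * m).
    { apply Rmult_le_pos; [|lra]. nra. }
    unfold m in *. lra. }
  assert (E2 : Rabs (P + Q - p - q) <= 2 * S * m ^ 2).
  { replace (P + Q - p - q) with ((P - p) + (Q - q)) by ring.
    eapply Rle_trans; [apply Rabs_triang|].
    assert (T1 := pow_le _ 2 Ap). assert (T2 := pow_le _ 2 Aq). nra. }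
  assert (E3 : Rabs (P + Q - p - q + s1 * p ^ 2 + s2 * q ^ 2)
               <= 2 * S ^ 2 * m ^ 3).
  { replace (P + Q - p - q + s1 * p ^ 2 + s2 * q ^ 2)
      with ((P - p + s1 * p ^ 2) + (Q - q + s2 * q ^ 2)) by ring.
    eapply Rle_trans; [apply Rabs_triang|].
    assert (T1 := pow_le _ 3 Ap). assert (T2 := pow_le _ 3 Aq).
    assert (T3 := pow_le S 2 ltac:(lra)). nra. }
  assert (E1 : Rabs (P + Q + p + q) <= 3 * m).
  { replace (P + Q + p + q) with ((P + Q) + (p + q)) by ring.
    eapply Rle_trans; [apply Rabs_triang|].
    assert (H := Rabs_triang p q). unfold m in *. lra. }
  (* An exact splitting, with [w = P + Q]: the arctangent error; the cubic tail of [PI / (d + w)];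
     the error of putting [p + q - s1 * p ^ 2 - s2 * q ^ 2] for [w] in the linear term; and that of
     putting [(p + q) ^ 2] for [w ^ 2], factored as a difference of squares. *)
  match goal with |- Rabs ?x <= _ => replace x with
    ((k * (d + P + Q) - PI) * / (d + (P + Q))
     + - (PI / d ^ 3 * (P + Q) ^ 3 * / (d + (P + Q)))
     + - (PI / d ^ 2 * (P + Q - p - q + s1 * p ^ 2 + s2 * q ^ 2))
     + PI / d ^ 3 * ((P + Q - p - q) * (P + Q + p + q))) by (field; lra) end.
  assert (Hd2 : 0 < PI / d ^ 2) by (apply Rdiv_lt_0_compat; [|apply pow_lt]; lra).
  assert (Hd3 : 0 < PI / d ^ 3) by (apply Rdiv_lt_0_compat; [|apply pow_lt]; lra).
  (* In the first two bounds, 8 is the cube of the 2 in [2 * m] and [2 / d] bounds [/ (d + w)];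
     together they give [16 / d]. *)
  assert (T1 : Rabs ((k * (d + P + Q) - PI) * / (d + (P + Q)))
               <= (2 * PI / d) ^ 3 * (8 * m ^ 3) * (2 / d)).
  { rewrite Rabs_mult, (Rabs_pos_eq (/ _)) by lra.
    apply Rmult_le_compat; [apply Rabs_pos | lra | | lra].
    eapply Rle_trans; [exact Hexp|]. apply Rmult_le_compat_l.
    - apply pow_le, Rlt_le, Rdiv_lt_0_compat; lra.
    - replace (8 * m ^ 3) with ((2 * m) ^ 3) by ring.
      apply pow_incr. split; [|unfold m; lra].
      apply Rplus_le_le_0_compat; apply Rabs_pos. }
  assert (T2 : Rabs (PI / d ^ 3 * (P + Q) ^ 3 * / (d + (P + Q)))
               <= PI / d ^ 3 * (8 * m ^ 3) * (2 / d)).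
  { rewrite !Rabs_mult, (Rabs_pos_eq (/ _)), (Rabs_pos_eq (PI / _)), <- RPow_abs
      by lra.
    apply Rmult_le_compat; [|lra| |lra].
    - apply Rmult_le_pos; [lra|]. apply pow_le, Rabs_pos.
    - apply Rmult_le_compat_l; [lra|].
      replace (8 * m ^ 3) with ((2 * m) ^ 3) by ring.
      apply pow_incr. split; [apply Rabs_pos | lra]. }
  assert (T3 : Rabs (PI / d ^ 2 * (P + Q - p - q + s1 * p ^ 2 + s2 * q ^ 2))
               <= PI / d ^ 2 * (2 * S ^ 2 * m ^ 3)).
  { rewrite Rabs_mult, (Rabs_pos_eq (PI / _)) by lra.
    apply Rmult_le_compat_l; lra. }
  assert (T4 : Rabs (PI / d ^ 3 * ((P + Q - p - q) * (P + Q + p + q)))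
               <= PI / d ^ 3 * ((2 * S * m ^ 2) * (3 * m))).
  { rewrite !Rabs_mult, (Rabs_pos_eq (PI / _)) by lra.
    apply Rmult_le_compat_l; [lra|].
    apply Rmult_le_compat; trivial; apply Rabs_pos. }
  eapply Rle_trans; [apply Rabs_triang|].
  eapply Rle_trans; [apply Rplus_le_compat_r, Rabs_triang|].
  eapply Rle_trans; [apply Rplus_le_compat_r, Rplus_le_compat_r, Rabs_triang|].
  rewrite !Rabs_Ropp.
  eapply Rle_trans.
  { apply Rplus_le_compat; [|exact T4]. apply Rplus_le_compat; [|exact T3].
    apply Rplus_le_compat; [exact T1|exact T2]. }
  right. field. lra.
Qed.

(** * Existence and expansion of the first resonance *)

Section FirstResonance.

Variables R1 R2 : R.
Hypothesis R1_gt0 : 0 < R1.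
Hypothesis R1_lt_R2 : R1 < R2.

(** Since [/ R2 <= / R1], the bound [R1 / 2] keeps both products of shift and variable within 1/2.
    The boundary lengths are then at most [2 * Rabs p] and [2 * Rabs q], with sum at most half the
    width of the shell. *)
Lemma first_resonance_iff (p q k : R) :
  p <> 0 -> q <> 0 -> Rabs p <= R1 / 2 -> Rabs q <= R1 / 2 ->
  Rabs p + Rabs q <= (R2 - R1) / 4 ->
  is_first_positive_root (resonance R1 R2 (/ p) (/ q)) k <->
  phase (R2 - R1) (/ (/ p + / R1)) (/ (/ q + - / R2)) k = PI.
Proof.
  intros Hp Hq Sp Sq Hpq.
  assert (H1 : 0 < / R1) by (apply Rinv_0_lt_compat; lra).
  assert (H2 : 0 < / R2) by (apply Rinv_0_lt_compat; lra).
  assert (H21 : / R2 <= / R1) by (apply Rinv_le_contravar; lra).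
  assert (HR1 : / R1 * (R1 / 2) = / 2) by (field; lra).
  assert (Ap := Rabs_pos p). assert (Aq := Rabs_pos q).
  destruct (shifted_inv_bounds (/ R1) p Hp) as (P0 & P1 & _).
  { rewrite Rabs_pos_eq; nra. }
  destruct (shifted_inv_bounds (- / R2) q Hq) as (Q0 & Q1 & _).
  { rewrite Rabs_Ropp, Rabs_pos_eq; nra. }
  rewrite <- first_root_sin_phase_iff by lra.
  apply is_first_positive_root_iff. intros x Hx.
  apply resonance_eq0_iff; trivial. lra.
Qed.

Lemma first_resonance_ex : exists K, is_first_resonance R1 R2 K.
Proof.
  assert (Hex : exists M, forall alpha1 alpha2,
    M < Rabs alpha1 -> M < Rabs alpha2 ->
    exists k, is_first_positive_root (resonance R1 R2 alpha1 alpha2) k).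
  (* The first summand forces [Rabs (/ a) <= R1 / 2], and the second forces each inverse below an
     eighth of the width, hence their sum below a quarter. *)
  { exists (2 / R1 + 8 / (R2 - R1)). intros alpha1 alpha2.
    assert (H1 : 0 < 2 / R1) by (apply Rdiv_lt_0_compat; lra).
    assert (H2 : 0 < 8 / (R2 - R1)) by (apply Rdiv_lt_0_compat; lra).
    assert (Hsmall : forall a, 2 / R1 + 8 / (R2 - R1) < Rabs a ->
      / a <> 0 /\ Rabs (/ a) <= R1 / 2 /\ Rabs (/ a) <= (R2 - R1) / 8).
    { intros a Ha.
      assert (Ha0 : a <> 0) by (intros ->; rewrite Rabs_R0 in Ha; lra).
      rewrite Rabs_inv. repeat split.
      - now apply Rinv_neq_0_compat.
      - replace (R1 / 2) with (/ (2 / R1)) by (field; lra).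
        apply Rinv_le_contravar; lra.
      - replace ((R2 - R1) / 8) with (/ (8 / (R2 - R1))) by (field; lra).
        apply Rinv_le_contravar; lra. }
    intros Ha1 Ha2.
    destruct (Hsmall _ Ha1) as (P0 & P1 & P2).
    destruct (Hsmall _ Ha2) as (Q0 & Q1 & Q2).
    assert (Hiff := fun k =>
      first_resonance_iff (/ alpha1) (/ alpha2) k P0 Q0 P1 Q1 ltac:(lra)).
    rewrite !Rinv_inv in Hiff.
    edestruct (phase_eq_PI_ex (R2 - R1)) as [k Hk];
      [lra | | exists k; apply Hiff, Hk].
    assert (I1 : 0 < / R1) by (apply Rinv_0_lt_compat; lra).
    assert (I2 : 0 < / R2) by (apply Rinv_0_lt_compat; lra).
    assert (I21 : / R2 <= / R1) by (apply Rinv_le_contravar; lra).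
    assert (HR1 : / R1 * (R1 / 2) = / 2) by (field; lra).
    assert (Ap := Rabs_pos (/ alpha1)). assert (Aq := Rabs_pos (/ alpha2)).
    destruct (shifted_inv_bounds (/ R1) (/ alpha1) P0) as (_ & B1 & _).
    { rewrite Rabs_pos_eq; nra. }
    destruct (shifted_inv_bounds (- / R2) (/ alpha2) Q0) as (_ & B2 & _).
    { rewrite Rabs_Ropp, Rabs_pos_eq; nra. }
    rewrite Rinv_inv in B1, B2. lra. }
  destruct Hex as [M HM].
  (* The root is chosen pointwise; below the threshold [M] the value is arbitrary. *)
  exists (fun alpha1 alpha2 => epsilon (inhabits 0)
    (is_first_positive_root (resonance R1 R2 alpha1 alpha2))).
  exists M. intros alpha1 alpha2 H1 H2. apply epsilon_spec. auto.
Qed.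

Lemma first_resonance_mixed_coefficient (K : R -> R -> R) :
  is_first_resonance R1 R2 K ->
  is_mixed_coefficient K (PI / (R2 - R1)) (2 * PI / (R2 - R1) ^ 3).
Proof.
  intros [M HM].
  set (d := R2 - R1). assert (Hd : 0 < d) by (unfold d; lra).
  assert (HPI := PI_RGT_0).
  (* The coefficients of the boundary expansion for the shifts [/ R1] and [- / R2]. *)
  exists (- (PI / d ^ 2)), (- (PI / d ^ 2)),
    (PI / d ^ 3 + PI / d ^ 2 * / R1), (PI / d ^ 3 + PI / d ^ 2 * - / R2).
  intros eps Heps.
  assert (I1 : 0 < / R1) by (apply Rinv_0_lt_compat; lra).
  assert (I2 : 0 < / R2) by (apply Rinv_0_lt_compat; lra).
  assert (I21 : / R2 <= / R1) by (apply Rinv_le_contravar; lra).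
  set (Cst := 16 / d * (2 * PI / d) ^ 3 + 16 / d * (PI / d ^ 3)
      + 2 * (/ R1) ^ 2 * (PI / d ^ 2) + 6 * / R1 * (PI / d ^ 3)).
  assert (HC : 0 <= Cst).
  { assert (0 < 16 / d) by (apply Rdiv_lt_0_compat; lra).
    assert (0 < (2 * PI / d) ^ 3) by (apply pow_lt, Rdiv_lt_0_compat; lra).
    assert (0 < PI / d ^ 2) by (apply Rdiv_lt_0_compat; [|apply pow_lt]; lra).
    assert (0 < PI / d ^ 3) by (apply Rdiv_lt_0_compat; [|apply pow_lt]; lra).
    unfold Cst. repeat apply Rplus_le_le_0_compat; apply Rmult_le_pos; nra. }
  (* The summands secure, in order, the two smallness conditions on [p], the inequality
     [M < Rabs (/ p)] whatever the sign of [M], and [4 * Cst * Rabs p <= eps]. *)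
  set (bound := 2 / R1 + 8 / d + (Rabs M + 1) + 4 * Cst / eps).
  assert (B1 : 0 < 2 / R1) by (apply Rdiv_lt_0_compat; lra).
  assert (B2 : 0 < 8 / d) by (apply Rdiv_lt_0_compat; lra).
  assert (B3 : M < Rabs M + 1) by (assert (H := Rle_abs M); lra).
  assert (B3' := Rabs_pos M).
  assert (B4 : 0 <= 4 * Cst / eps).
  { apply Rmult_le_pos; [lra|]. now apply Rlt_le, Rinv_0_lt_compat. }
  assert (Hb : 0 < bound) by (unfold bound; lra).
  exists (/ bound). split; [now apply Rinv_0_lt_compat|].
  assert (Hsmall : forall p, 0 < Rabs p < / bound ->
    p <> 0 /\ Rabs p <= R1 / 2 /\ Rabs p <= d / 8 /\ M < Rabs (/ p) /\
    4 * Cst * Rabs p <= eps).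
  { intros p [Hp0 Hp].
    assert (Hpn : p <> 0) by (intros ->; rewrite Rabs_R0 in Hp0; lra).
    assert (Hip : bound < / Rabs p).
    { rewrite <- (Rinv_inv bound). apply Rinv_lt_contravar; [|trivial].
      apply Rmult_lt_0_compat; [trivial | now apply Rinv_0_lt_compat]. }
    assert (E : / Rabs p * Rabs p = 1) by (field; lra).
    repeat split; trivial.
    - assert (F : 2 / R1 * (R1 / 2) = 1) by (field; lra).
      assert (2 / R1 < / Rabs p) by (unfold bound in Hip; lra). nra.
    - assert (F : 8 / d * (d / 8) = 1) by (field; lra).
      assert (8 / d < / Rabs p) by (unfold bound in Hip; lra). nra.
    - rewrite Rabs_inv. unfold bound in Hip. lra.
    - assert (F : 4 * Cst = 4 * Cst / eps * eps) by (field; lra).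
      assert (4 * Cst / eps < / Rabs p) by (unfold bound in Hip; lra).
      rewrite F. nra. }
  intros p q Hp Hq.
  destruct (Hsmall p Hp) as (P0 & P1 & P2 & P3 & P4).
  destruct (Hsmall q Hq) as (Q0 & Q1 & Q2 & Q3 & Q4).
  assert (HR1 : / R1 * (R1 / 2) = / 2) by (field; lra).
  assert (Hk := HM _ _ P3 Q3).
  apply first_resonance_iff in Hk; trivial; [|fold d; lra].
  assert (H := phase_eq_PI_boundary_expansion d (/ R1) (- / R2) (/ R1) p q
                 (K (/ p) (/ q)) Hd).
  lapply H; clear H; [intros H | rewrite Rabs_pos_eq; lra].
  lapply H; clear H; [intros H | rewrite Rabs_Ropp, Rabs_pos_eq; lra].
  specialize (H P0 Q0 ltac:(nra) ltac:(nra) ltac:(lra) Hk).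
  fold Cst in H.
  match goal with H : Rabs ?x <= _ |- Rabs ?y <= _ => replace y with x by ring end.
  eapply Rle_trans; [exact H|].
  rewrite <- (pow2_abs p), <- (pow2_abs q).
  set (a := Rabs p) in *. set (b := Rabs q) in *.
  assert (Hm2 : (a + b) ^ 2 <= 2 * (a ^ 2 + b ^ 2))
    by (assert (T := pow2_ge_0 (a - b)); lra).
  (* One factor [a + b] of the cubic error is spent on [Cst * (a + b) <= eps / 2]; the remaining
     square is at most [2 * (a ^ 2 + b ^ 2)]. *)
  replace (Cst * (a + b) ^ 3) with (Cst * (a + b) * (a + b) ^ 2) by ring.
  apply Rle_trans with (eps / 2 * (2 * (a ^ 2 + b ^ 2))); [|right; field].
  apply Rmult_le_compat; trivial.
  - apply Rmult_le_pos; lra.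
  - apply pow2_ge_0.
  - lra.
Qed.

End FirstResonance.

Theorem theorem3p4 (R1 R2 kDD : R) (hR1 : 0 < R1) (hR12 : R1 < R2)
    (hk : is_first_positive_root (A0 R1 R2) kDD) :
  (exists K : R -> R -> R, is_first_resonance R1 R2 K) /\
  (forall K : R -> R -> R, is_first_resonance R1 R2 K ->
     is_mixed_coefficient K kDD (g01 R1 R2 kDD)) /\
  g01 R1 R2 kDD = 2 * PI / (R2 - R1) ^ 3.
Proof.
  (* With [P = Q = 0] the phase is linear, so the equation for its value [PI] is solved
     explicitly. *)
  assert (HkDD : kDD = PI / (R2 - R1)).
  { apply (is_first_positive_root_iff _ (fun k => sin (phase (R2 - R1) 0 0 k)))
      in hk; [|intros k Hk; apply A0_eq0_iff; lra].
    apply first_root_sin_phase_iff in hk; [|lra|rewrite Rabs_R0; lra].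
    unfold phase in hk. rewrite !Rmult_0_r, atan_0 in hk.
    rewrite <- hk. field. lra. }
  rewrite HkDD, g01_eq by trivial.
  split; [now apply first_resonance_ex | split; [|easy]].
  intros K HK. now apply first_resonance_mixed_coefficient.
Qed.
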